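(* Let $(R,\mathfrak{m})$ be a Noetherian local ring of dimension $d>0$. Let $I_\bullet=\{I_n\}_{n\in\mathbb{N}}$ be an arbitrary graded family of $\mathfrak{m}$-primary ideals in $R$. Then there exists a constant $\gamma>0$ such that for all integers $n\ge 1$, $$\ell_R(R/I_{n+1})-\ell_R(R/I_n)<\gamma\, n^{d-1}.$$
   Context: $\mathbb{N}$ is the set of non-negative integers and $\ell_R(-)$ denotes the length of an $R$-module. A graded family of $\mathfrak{m}$-primary ideals in $R$ is a family $\{I_n\}_{n\in\mathbb{N}}$ of ideals of $R$ such that $I_0=R$, $I_mI_n\subseteq I_{m+n}$ for all $m,n\in\mathbb{N}$, and $I_n$ is $\mathfrak{m}$-primary for every $n\ge 1$. The family is not assumed to be decreasing. The constant $\gamma$ may depend on $R$ and on the family. *)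

(* Defs.v *)
From HB Require Import structures.
From mathcomp Require Import all_boot all_order all_algebra.
From mathcomp Require Import generic_quotient ring_quotient.
From mathcomp Require Import all_classical all_reals ereal.

Set Implicit Arguments.
Unset Strict Implicit.
Unset Printing Implicit Defensive.

Import Order.TTheory GRing.Theory Num.Theory.

Local Open Scope ring_scope.
Local Open Scope quotient_scope.

(* Submodules, and ideals below, are boolean predicates: by the classical
   axioms of [boolp] every subset is one, so nothing is lost. *)

(* [submodClosed] only bundles closure under addition and scaling; over a ring
   this gives closure under opposite, which [ring_quotient] requires. *)
Lemma submodClosed_zmod (R : nzRingType) (V : lmodType R) (N : submodClosed V) :
  zmod_closed N.
Proof. exact: GRing.submod_closedB (submodClosedP N). Qed.

Definition zmod_of_submod (R : nzRingType) (V : lmodType R)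
    (N : submodClosed V) : zmodClosed V :=
  let S : V -> bool := fun x => x \in N in
  HB.pack S (GRing.isZmodClosed.Build V S (submodClosed_zmod N)).

Definition quotmod (R : nzRingType) (V : lmodType R) (N : submodClosed V) : Type :=
  Quotient.quot (zmod_of_submod N).

Section QuotientModule.
Variables (R : nzRingType) (V : lmodType R) (N : submodClosed V).

HB.instance Definition _ := GRing.Zmodule.on (quotmod N).
HB.instance Definition _ := EqQuotient.on (quotmod N).

Definition quotmod_scale (a : R) : quotmod N -> quotmod N :=
  fun x => \pi_(quotmod N) (a *: repr x).

Lemma quotmod_piE (x y : V) :
  (\pi_(quotmod N) x == \pi_(quotmod N) y) = (x - y \in N).
Proof. exact: esym (Quotient.idealrBE (zmod_of_submod N) x y). Qed.

Lemma quotmod_piD (x y : V) :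
  \pi_(quotmod N) (x + y) = \pi_(quotmod N) x + \pi_(quotmod N) y.
Proof. exact: (raddfD (\pi_(Quotient.quot (zmod_of_submod N)))). Qed.

Lemma quotmod_piZ (a : R) (x : V) :
  quotmod_scale a (\pi_(quotmod N) x) = \pi_(quotmod N) (a *: x).
Proof.
apply/eqP; rewrite /quotmod_scale quotmod_piE -scalerBr rpredZ //.
by rewrite -quotmod_piE reprK.
Qed.

Lemma quotmod_pi_surj (x : quotmod N) : exists v : V, x = \pi_(quotmod N) v.
Proof. by exists (repr x); rewrite reprK. Qed.

Lemma quotmod_scaleA (a b : R) (x : quotmod N) :
  quotmod_scale a (quotmod_scale b x) = quotmod_scale (a * b) x.
Proof. by have [v ->] := quotmod_pi_surj x; rewrite !quotmod_piZ scalerA. Qed.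

Lemma quotmod_scale1 : left_id 1 quotmod_scale.
Proof.
by move=> x; have [v ->] := quotmod_pi_surj x; rewrite quotmod_piZ scale1r.
Qed.

Lemma quotmod_scaleDr : right_distributive quotmod_scale +%R.
Proof.
move=> a x y; have [v ->] := quotmod_pi_surj x; have [w ->] := quotmod_pi_surj y.
by rewrite -quotmod_piD !quotmod_piZ -quotmod_piD scalerDr.
Qed.

Lemma quotmod_scaleDl (x : quotmod N) :
  {morph quotmod_scale^~ x : a b / a + b}.
Proof.
move=> a b; have [v ->] := quotmod_pi_surj x.
by rewrite !quotmod_piZ -quotmod_piD scalerDl.
Qed.

HB.instance Definition _ := GRing.Zmodule_isLmodule.Build R (quotmod N)
  quotmod_scaleA quotmod_scale1 quotmod_scaleDr quotmod_scaleDl.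

End QuotientModule.

Definition strict_sub (T : Type) (A B : {pred T}) : Prop :=
  {subset A <= B} /\ exists x, x \in B /\ x \notin A.

Definition submod_chain (R : nzRingType) (V : lmodType R) (n : nat)
    (N : nat -> submodClosed V) : Prop :=
  forall i, (i < n)%N -> strict_sub (N i) (N i.+1).

(* Supremum in [0, +oo]. Beware that +oo - +oo = -oo in [\bar K]; quotients of a
   noetherian local ring by m-primary ideals do have finite length. *)
Definition module_length (K : realType) (R : nzRingType) (V : lmodType R) :
    \bar K :=
  ereal_sup [set (n%:R%:E)%E | n in
    [set n : nat | exists N : nat -> submodClosed V, submod_chain n N]]%classic.

(* An ideal of a commutative ring is a submodule of the regular module; unlike
   [idealr R], this type contains the unit ideal. *)
Notation ideal R := (submodClosed R^o).

Definition noetherian (R : comNzRingType) : Prop :=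
  forall J : ideal R, exists s : seq R, forall x : R,
    x \in J <-> exists c : nat -> R, x = \sum_(i < size s) c i * s`_i.

(* Elements of [idealr R] and [prime_idealr R] are proper. *)
Definition maximal_ideal (R : comNzRingType) (M : idealr R) : Prop :=
  forall J : idealr R, {subset M <= J} -> {subset J <= M}.

Definition local_ring (R : comNzRingType) (m : idealr R) : Prop :=
  maximal_ideal m /\ forall M : idealr R, maximal_ideal M -> M =i m.

Definition prime_chain (R : comNzRingType) (n : nat)
    (P : nat -> prime_idealr R) : Prop :=
  forall i, (i < n)%N -> strict_sub (P i) (P i.+1).

Definition krull_dim (R : comNzRingType) (d : nat) : Prop :=
  (exists P : nat -> prime_idealr R, prime_chain d P) /\
  (forall (n : nat) (P : nat -> prime_idealr R), prime_chain n P -> (n <= d)%N).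

Definition in_radical (R : comNzRingType) (J : ideal R) (x : R) : Prop :=
  exists k : nat, x ^+ k \in J.

Definition primary_ideal (R : comNzRingType) (J : ideal R) : Prop :=
  (1 : R) \notin J /\
  forall a b : R, a * b \in J -> a \in J \/ in_radical J b.

Definition m_primary (R : comNzRingType) (m : idealr R) (J : ideal R) : Prop :=
  primary_ideal J /\ forall x : R, in_radical J x <-> x \in m.

Definition in_ideal_prod (R : comNzRingType) (I J : ideal R) (x : R) : Prop :=
  exists s : seq (R * R),
    (forall p, p \in s -> p.1 \in I /\ p.2 \in J) /\
    x = \sum_(p <- s) p.1 * p.2.

Definition graded_family (R : comNzRingType) (m : idealr R)
    (I : nat -> ideal R) : Prop :=
  [/\ forall x : R, x \in I 0%N,
      forall (i j : nat) (x : R), in_ideal_prod (I i) (I j) x -> x \in I (i + j)%N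
    & forall n : nat, (1 <= n)%N -> m_primary m (I n)].

(* Main.v *)
(* Choose a system of parameters x_1, ..., x_d inside I_1, so that x_i^n lies in
   I_n, and put x = x_1.  Since x I_n is contained in I_{n+1},
     l(R/I_{n+1}) = l(R/(I_{n+1} : x)) + l(R/(I_{n+1} + xR))
                 <= l(R/I_n) + l(R/(x_1, x_2^{n+1}, ..., x_d^{n+1})),
   and the last length is at most (n+1)^{d-1} l(R/(x_1, ..., x_d)).
   The system of parameters comes from prime avoidance, and the finiteness of
   its colength from noetherian induction on ideals. *)

Require Import Defs.
From Stdlib Require List.
From HB Require Import structures.
From mathcomp Require Import all_boot all_order all_algebra.
From mathcomp Require Import generic_quotient ring_quotient.
From mathcomp Require Import all_classical all_reals ereal.

Set Implicit Arguments.
Unset Strict Implicit.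
Unset Printing Implicit Defensive.

Import Order.TTheory GRing.Theory Num.Theory.

(** * Submodules cut out by propositions *)

Section SubmodulesFromProp.
Local Open Scope ring_scope.
Variables (R : nzRingType) (V : lmodType R).

Definition submod_axioms (P : V -> Prop) : Prop :=
  [/\ P 0, forall x y, P x -> P y -> P (x + y) & forall (a : R) x, P x -> P (a *: x)].

Lemma submod_axioms_closed (P : V -> Prop) :
  submod_axioms P -> GRing.submod_closed (fun x => `[<P x>]).
Proof.
case=> P0 PD PZ; split; first exact/asboolP.
by move=> a x y /asboolP Px /asboolP Py; apply/asboolP/PD => //; apply: PZ.
Qed.

Definition submod_of (P : V -> Prop) (hP : submod_axioms P) : submodClosed V :=
  let S : V -> bool := fun x => `[<P x>] in
  HB.pack S (GRing.isSubmodClosed.Build R V S (submod_axioms_closed hP)).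

Lemma mem_submod_of (P : V -> Prop) (hP : submod_axioms P) (x : V) :
  x \in submod_of hP <-> P x.
Proof. by split => [/asboolP|Px] //; apply/asboolP. Qed.

End SubmodulesFromProp.

(** * Strict chains and strict inclusions *)

Lemma chain_extend (T : Type) (r : T -> T -> Prop) (n : nat) (f : nat -> T) (y : T) :
  (forall i, (i < n)%N -> r (f i) (f i.+1)) -> r (f n) y ->
  exists g : nat -> T,
    [/\ forall i, (i < n.+1)%N -> r (g i) (g i.+1), g 0 = f 0 & g n.+1 = y].
Proof.
move=> rf ry; exists (fun i => if (i <= n)%N then f i else y); split => //=.
- move=> i lt_in1; rewrite -ltnS lt_in1; move: lt_in1.
  rewrite ltnS; case: ltngtP => // [lt_in|->] _; [exact: rf | exact: ry].
- by rewrite ltnn.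
Qed.

Lemma eq_or_strict_sub (T : Type) (A B : {pred T}) :
  {subset A <= B} -> A =i B \/ strict_sub A B.
Proof.
move=> sAB; case: (pselect {subset B <= A}) => [sBA|nsBA].
  by left=> x; apply/idP/idP => [/sAB|/sBA].
right; split=> //; apply: contrapT => nex; apply: nsBA => x xB.
by apply: contrapT => /negP xA; apply: nex; exists x.
Qed.

(** * Ideal operations and passage between the types of ideals *)

Section Ideals.
Local Open Scope ring_scope.
Variable R : comNzRingType.
Implicit Types (J N : ideal R) (a x y : R) (s : seq R).

Lemma memI0 J : (0 : R) \in J. Proof. exact: (rpred0 J). Qed.
Lemma memID J x y : x \in J -> y \in J -> x + y \in J.
Proof. exact: (@rpredD R^o J). Qed.
Lemma memIM J a x : x \in J -> a * x \in J.
Proof. exact: (@rpredZ R R^o J a x). Qed.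
Lemma memIB J x y : x \in J -> y \in J -> x - y \in J.
Proof. by move=> xJ yJ; rewrite -mulN1r memID ?memIM. Qed.
Lemma memIBr J x y : y \in J -> x - y \in J -> x \in J.
Proof. by move=> yJ xyJ; rewrite -(subrK y x) memID. Qed.

Lemma ideal_axioms (P : R -> Prop) :
  P 0 -> (forall x y, P x -> P y -> P (x + y)) -> (forall a x, P x -> P (a * x)) ->
  @submod_axioms R R^o P.
Proof. by []. Qed.

Lemma colon_axioms J a : @submod_axioms R R^o (fun x : R => a * x \in J).
Proof.
apply: ideal_axioms => [|x y|b x] /=; first by rewrite mulr0 memI0.
  by rewrite mulrDr; apply: memID.
by rewrite mulrCA; apply: memIM.
Qed.

Definition colon J a : ideal R := submod_of (colon_axioms J a).

Lemma mem_colon J a x : x \in colon J a <-> a * x \in J.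
Proof. exact: (mem_submod_of (colon_axioms J a) x). Qed.

Lemma adjoin_axioms J a :
  @submod_axioms R R^o (fun x : R => exists r, x - r * a \in J).
Proof.
apply: ideal_axioms => [|x y [r xJ] [s yJ]|b x [r xJ]].
- by exists 0; rewrite mul0r subr0 memI0.
- by exists (r + s); rewrite mulrDl opprD addrACA memID.
- by exists (b * r); rewrite -mulrA -mulrBr memIM.
Qed.

(** This is [J + aR], so [foldl adjoin J s] is the ideal generated by [J] and the entries of [s]. *)
Definition adjoin J a : ideal R := submod_of (adjoin_axioms J a).

Lemma mem_adjoin J a x : x \in adjoin J a <-> exists r, x - r * a \in J.
Proof. exact: (mem_submod_of (adjoin_axioms J a) x). Qed.

Lemma sub_adjoin J a : {subset J <= adjoin J a}.
Proof. by move=> x xJ; apply/mem_adjoin; exists 0; rewrite mul0r subr0. Qed.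

Lemma adjoin_gen J a : a \in adjoin J a.
Proof. by apply/mem_adjoin; exists 1; rewrite mul1r subrr memI0. Qed.

Lemma adjoin_sub J N a : {subset J <= N} -> a \in N -> {subset adjoin J a <= N}.
Proof.
move=> sJN aN x /mem_adjoin[r /sJN xN].
by apply: memIBr xN; apply: (memIM r aN).
Qed.

Lemma strict_adjoin J a : a \notin J -> strict_sub J (adjoin J a).
Proof. by split; [exact: sub_adjoin | exists a; rewrite adjoin_gen]. Qed.

Lemma sub_adjoins J s : {subset J <= foldl adjoin J s}.
Proof. by elim: s J => [|a s IHs] J x xJ //=; apply/IHs/sub_adjoin. Qed.

Lemma adjoins_gen J s x : x \in s -> x \in foldl adjoin J s.
Proof.
elim: s J => //= a s IHs J; rewrite inE => /predU1P[->|]; last exact: IHs.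
exact/sub_adjoins/adjoin_gen.
Qed.

Lemma adjoins_sub J N s :
  {subset J <= N} -> (forall x, x \in s -> x \in N) -> {subset foldl adjoin J s <= N}.
Proof.
elim: s J => //= a s IHs J sJN sN; apply: IHs.
  by apply: adjoin_sub => //; apply: sN; rewrite mem_head.
by move=> x xs; apply: sN; rewrite inE xs orbT.
Qed.

Lemma zero_axioms : @submod_axioms R R^o (fun x : R => x = 0).
Proof.
apply: ideal_axioms => [//|x y -> ->|a x ->]; first exact: addr0.
exact: mulr0.
Qed.

Definition zeroI : ideal R := submod_of zero_axioms.

Lemma mem_zeroI (x : R) : x \in zeroI <-> x = 0.
Proof. exact: (mem_submod_of zero_axioms x). Qed.

Lemma ideal_of_idealr_axioms (p : idealr R) :
  @submod_axioms R R^o (fun x : R => x \in p).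
Proof.
apply: ideal_axioms => [|x y|a x]; [exact: idealr0 | exact: rpredD |].
exact: idealMr.
Qed.

Definition ideal_of_idealr (p : idealr R) : ideal R :=
  submod_of (ideal_of_idealr_axioms p).

Lemma mem_ideal_of_idealr (p : idealr R) (x : R) : x \in ideal_of_idealr p <-> x \in p.
Proof. exact: (mem_submod_of (ideal_of_idealr_axioms p) x). Qed.

Definition ideal_pred J : R -> bool := fun x => x \in J.

Lemma proper_idealr_closed J : (1 : R) \notin J -> idealr_closed (ideal_pred J).
Proof.
move=> J1; split; [exact: memI0 | exact: J1 |].
by move=> a x y xJ yJ; apply: memID => //; apply: memIM.
Qed.

Definition idealr_of_ideal J (J1 : (1 : R) \notin J) : idealr R :=
  let S : R -> bool := ideal_pred J in
  HB.pack S (isIdealr.Build R S (proper_idealr_closed J1)).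

Definition prime_of_ideal J (J1 : (1 : R) \notin J)
    (Jp : prime_idealr_closed (ideal_pred J)) : prime_idealr R :=
  let S : R -> bool := ideal_pred J in
  HB.pack S (isIdealr.Build R S (proper_idealr_closed J1))
    (isPrimeIdealrClosed.Build R S Jp).

Lemma mem_prime_of_ideal J (J1 : (1 : R) \notin J)
    (Jp : prime_idealr_closed (ideal_pred J)) (x : R) :
  (x \in prime_of_ideal J1 Jp) = (x \in J).
Proof. by []. Qed.

Lemma prime_mem_exp (p : prime_idealr R) (x : R) n : x ^+ n \in p -> x \in p.
Proof.
elim: n => [|n IHn]; first by rewrite expr0 idealr1.
by rewrite exprS prime_idealrM => /orP[].
Qed.

End Ideals.

(** * Noetherian induction, minimal primes and prime avoidance *)

Section Noetherian.
Local Open Scope ring_scope.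
Variable R : comNzRingType.
Implicit Types (J N : ideal R) (a x y : R) (s : seq R).

Lemma ascending_sub (N : nat -> ideal R) :
  (forall i, {subset N i <= N i.+1}) ->
  forall i j, (i <= j)%N -> {subset N i <= N j}.
Proof.
move=> sN i j /subnK <- x xi; elim: (j - i)%N => // k; exact: sN.
Qed.

Lemma union_axioms (N : nat -> ideal R) :
  (forall i, {subset N i <= N i.+1}) ->
  @submod_axioms R R^o (fun x : R => exists i, x \in N i).
Proof.
move=> sN.
have mN := ascending_sub sN.
apply: ideal_axioms => [|x y [i xi] [j yj]|a x [i xi]].
- by exists 0%N; apply: memI0.
- exists (maxn i j); apply: memID.
    exact: mN (leq_maxl i j) _ xi.
  exact: mN (leq_maxr i j) _ yj.
- by exists i; apply: memIM.
Qed.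

(** The union of an ascending chain is an ideal; its finitely many generators all lie in one [N k],
    so the step from [N k] to [N k.+1] cannot be strict. *)
Lemma noetherian_chain_stops (N : nat -> ideal R) :
  noetherian R -> exists i, ~ strict_sub (N i) (N i.+1).
Proof.
move=> noeR; apply: contrapT => nex.
have strN i : strict_sub (N i) (N i.+1).
  by apply: contrapT => nstr; apply: nex; exists i.
have sN i : {subset N i <= N i.+1} by case: (strN i).
have mN := ascending_sub sN.
pose U : ideal R := submod_of (union_axioms sN).
have memU (x : R) : x \in U <-> exists i, x \in N i.
  exact: (mem_submod_of (union_axioms sN) x).
have [s sU] := noeR U.
have [k sk] : exists k, forall i : nat, (i < size s)%N -> s`_i \in N k.
  have sinU i : (i < size s)%N -> s`_i \in U.
    (* Kronecker delta coefficients show that each generator lies in [U]. *)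
    move=> lt_is; apply/sU; exists (fun j => (j == i)%:R).
    rewrite (bigD1 (Ordinal lt_is)) //= eqxx mul1r big1 ?addr0 // => j neq_ji.
    by rewrite -val_eqE in neq_ji; rewrite (negPf neq_ji) mul0r.
  elim: s {sU} sinU => [|a s IHs] sinU; first by exists 0%N.
  have [k sk] : exists k, forall i : nat, (i < size s)%N -> s`_i \in N k.
    by apply: IHs => i lt_is; apply: (sinU i.+1).
  have [j aj] : exists j, a \in N j by apply/memU/(sinU 0%N).
  exists (maxn j k) => -[_|i lt_is] /=; first exact: mN (leq_maxl j k) _ aj.
  exact: mN (leq_maxr j k) _ (sk i lt_is).
have [_ [y [yN /negP]]] := strN k; apply.
have /sU[c ->] : y \in U by apply/memU; exists k.+1.
elim/big_ind: _ => [|u v|i _]; [exact: memI0 | exact: memID |].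
by apply: memIM; apply: sk.
Qed.

(** If [P] failed somewhere, each failing ideal would lie strictly inside another one, and choice
    would iterate this into an infinite strict chain. *)
Lemma noetherian_ind (P : ideal R -> Prop) :
  noetherian R ->
  (forall J, (forall J', strict_sub J J' -> P J') -> P J) -> forall J, P J.
Proof.
move=> noeR IH J0; apply: contrapT => nPJ0.
have next (J : {J : ideal R | ~ P J}) :
    exists J' : {J : ideal R | ~ P J}, strict_sub (sval J) (sval J').
  case: J => J nPJ /=; apply: contrapT => nex; apply: nPJ; apply: IH => J' ltJ.
  by apply: contrapT => nPJ'; apply: nex; exists (exist _ J' nPJ').
have [g gP] := choice next.
have [i] := noetherian_chain_stops (fun i => sval (iter i g (exist _ J0 nPJ0))) noeR.
exact.
Qed.

(** A proper ideal that is not prime contains some [a * b] with [a] and [b] outside it, and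
    adjoining either factor enlarges it strictly. Both the finiteness of minimal primes and that of
    colength are proved by this induction. *)
Lemma noetherian_prime_ind (P : ideal R -> Prop) :
  noetherian R ->
  (forall J, (1 : R) \in J -> P J) ->
  (forall J (p : prime_idealr R), J =i p -> P J) ->
  (forall J a b, a * b \in J -> P (adjoin J a) -> P (adjoin J b) -> P J) ->
  forall J, P J.
Proof.
move=> noeR P1 Pprime Pmul; apply: noetherian_ind => // J IH.
case J1 : ((1 : R) \in J); first exact: P1.
move/negbT: J1 => J1.
case: (pselect (prime_idealr_closed (ideal_pred J))) => [Jp|nJp].
  exact: (Pprime J (prime_of_ideal J1 Jp)).
have [a [b [abJ aJ bJ]]] : exists a b, [/\ a * b \in J, a \notin J & b \notin J].
  apply: contrapT => nex; apply: nJp => a b abJ; apply: contrapT.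
  by move=> /negP; rewrite negb_or => /andP[aJ bJ]; apply: nex; exists a, b.
by apply: (Pmul J a b) => //; apply/IH/strict_adjoin.
Qed.

(** The list may contain more than the minimal primes of [J]; what counts is that every prime over
    [J] lies above a listed prime over [J]. If [a * b] is in [J], a prime over [J] contains [a] or
    [b], so the lists for the two enlarged ideals can be concatenated. *)
Lemma minimal_primes_finite J : noetherian R ->
  exists ps : seq (prime_idealr R),
    forall q : prime_idealr R, (forall x, x \in J -> x \in q) ->
      exists p, [/\ List.In p ps, forall x, x \in J -> x \in p & {subset p <= q}].
Proof.
move=> noeR; elim/noetherian_prime_ind: J => //.
- move=> J J1; exists [::] => q sJq.
  by have := sJq _ J1; rewrite idealr1.
- move=> J p eqJp; exists [:: p] => q sJq; exists p; split=> [|x|x].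
  + by left.
  + by rewrite -eqJp.
  + by rewrite -eqJp; apply: sJq.
- move=> J a b abJ [ps psP] [qs qsP]; exists (ps ++ qs) => q sJq.
  have adjq c : c \in q -> forall x, x \in adjoin J c -> x \in q.
    move=> cq x /mem_adjoin[r /sJq xq]; rewrite -(subrK (r * c) x) rpredD //.
    exact: idealMr.
  have := sJq _ abJ; rewrite prime_idealrM => /orP[aq|bq].
    have [p [p_in sJp spq]] := psP q (adjq a aq); exists p; split => //.
      by apply/List.in_or_app; left.
    by move=> x xJ; apply/sJp/sub_adjoin.
  have [p [p_in sJp spq]] := qsP q (adjq b bq); exists p; split => //.
    by apply/List.in_or_app; right.
  by move=> x xJ; apply/sJp/sub_adjoin.
Qed.

(** Multiply together one element of each [q] outside [p]; the product stays outside [p] because [p]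
    is prime. *)
Lemma prime_separation (p : prime_idealr R) (ps : seq (prime_idealr R)) :
  (forall q, List.In q ps -> ~ {subset q <= p}) ->
  exists y : R, y \notin p /\ forall q, List.In q ps -> y \in q.
Proof.
elim: ps => [|q ps IHps] nsub.
  by exists 1; rewrite idealr1.
have [|y [yp yps]] := IHps; first by move=> q' q'in; apply: nsub; right.
have [z [zq zp]] : exists z, z \in q /\ z \notin p.
  apply: contrapT => nex; apply: (nsub q); first by left.
  by move=> z zq; apply: contrapT => /negP zp; apply: nex; exists z.
exists (y * z); split; first by rewrite prime_idealrM negb_or yp.
move=> q' [<-|q'in]; first exact: idealMr.
by rewrite mulrC; apply: idealMr; apply: yps.
Qed.

Lemma prime_avoidance (A : ideal R) (ps : seq (prime_idealr R)) :
  (forall p, List.In p ps -> ~ (forall x, x \in A -> x \in p)) ->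
  exists x : R, x \in A /\ forall p, List.In p ps -> x \notin p.
Proof.
have [n] := ubnP (size ps); elim: n ps => // n IHn [|p ps] /= le_n nsub.
  by exists 0; split=> //; apply: memI0.
(* Primes contained in [p] are avoided as soon as [p] is, so only the others are kept. *)
pose ps' := List.filter (fun q : prime_idealr R => ~~ `[<{subset q <= p}>]) ps.
have ps'P q : List.In q ps' <-> List.In q ps /\ ~ {subset q <= p}.
  by rewrite List.filter_In; split=> -[qin /asboolPn].
have psP x : x \notin p -> (forall q, List.In q ps' -> x \notin q) ->
    forall q, List.In q (p :: ps) -> x \notin q.
  move=> xp xps' q [<-//|qin].
  case: (pselect {subset q <= p}) => [sqp|nsqp].
    by apply: contra xp => /sqp.
  exact/xps'/ps'P.
have [||x [xA xps']] := IHn ps'.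
- rewrite ltnS in le_n; apply: leq_ltn_trans le_n.
  by apply/ssrnat.leP; exact: List.filter_length_le.
- by move=> q /ps'P[qin _]; apply: nsub; right.
case xp : (x \in p); last by exists x; split => //; apply: psP => //; rewrite xp.
have [|y [yp yps']] := @prime_separation p ps'; first by move=> q /ps'P[].
have [a [aA ap]] : exists a, a \in A /\ a \notin p.
  apply: contrapT => nex; apply: (nsub p); first by left.
  by move=> z zA; apply: contrapT => /negP zp; apply: nex; exists z.
(* Modulo [p] only the term [y * a] survives, modulo each prime of [ps'] only [x] does, and neither
   vanishes there. *)
exists (x + y * a); split; first by apply: memID => //; apply: memIM.
apply: psP => [|q qin].
  by rewrite rpredDl // prime_idealrM negb_or yp.
by rewrite rpredDr ?xps' // mulrC idealMr // yps'.
Qed.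

End Noetherian.

(** * Local rings, heights and systems of parameters *)

Section LocalRing.
Local Open Scope ring_scope.
Variables (R : comNzRingType) (m : idealr R).
Hypotheses (noeR : noetherian R) (locR : local_ring m).
Implicit Types (J N : ideal R) (a x y : R) (s : seq R).

(** Noetherian induction takes the place of Zorn's lemma: a proper ideal is either maximal, hence
    equal to [m], or strictly contained in a larger proper ideal. *)
Lemma proper_sub_maximal J : (1 : R) \notin J -> forall x, x \in J -> x \in m.
Proof.
elim/noetherian_ind: J => // J IH J1 x xJ.
case: (pselect (maximal_ideal (idealr_of_ideal J1))) => [maxJ|nmaxJ].
  by rewrite -(locR.2 _ maxJ).
have [M [sJM nsMJ]] : exists M : idealr R,
    {subset J <= M} /\ ~ {subset M <= J}.
  apply: contrapT => nex; apply: nmaxJ => M sJM; apply: contrapT => nsMJ.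
  by apply: nex; exists M.
have sJM' : {subset J <= ideal_of_idealr M}.
  by move=> y /sJM yM; apply/mem_ideal_of_idealr.
apply: (IH (ideal_of_idealr M)) => //; last exact: sJM'.
- case: (eq_or_strict_sub sJM') => // eqJM; case: nsMJ => y yM.
  by rewrite eqJM; apply/mem_ideal_of_idealr.
- by apply/negP => /mem_ideal_of_idealr; rewrite idealr1.
Qed.

Lemma maximal_ideal_prime : exists p : prime_idealr R, p =i m.
Proof.
pose M := ideal_of_idealr m.
have M1 : (1 : R) \notin M by apply/negP => /mem_ideal_of_idealr; rewrite idealr1.
have Mp : prime_idealr_closed (ideal_pred M).
  move=> a b abM; apply: contrapT => /negP; rewrite negb_or => /andP[aM bM].
  (* If [1 - r * a] lies in [m], then so does [b * (1 - r * a)], and hence [b]. Otherwise [m + aR]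
     is proper and therefore inside [m], which puts [a] in [m]. *)
  case A1 : ((1 : R) \in adjoin M a).
    have /mem_adjoin[r rM] := A1; case/negP: bM.
    apply: (@memIBr _ M _ (r * (a * b))); first exact: memIM.
    have -> : b - r * (a * b) = b * (1 - r * a).
      by rewrite mulrBr mulr1 [b * _]mulrC mulrA.
    exact: memIM.
  case/negP: aM; apply/mem_ideal_of_idealr.
  apply: (proper_sub_maximal (negbT A1)); exact: adjoin_gen.
exists (prime_of_ideal M1 Mp) => x; rewrite mem_prime_of_ideal.
by apply/idP/idP => /mem_ideal_of_idealr.
Qed.

Lemma prime_sub_maximal (p : prime_idealr R) : {subset p <= m}.
Proof.
move=> x xp; apply: (@proper_sub_maximal (ideal_of_idealr p)).
  by apply/negP => /mem_ideal_of_idealr; rewrite idealr1.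
exact/mem_ideal_of_idealr.
Qed.

Definition height_ge (n : nat) (p : prime_idealr R) : Prop :=
  exists P : nat -> prime_idealr R, prime_chain n P /\ P n =i p.

Implicit Types p q : prime_idealr R.

Lemma prime_chain_extend n (P : nat -> prime_idealr R) q :
  prime_chain n P -> strict_sub (P n) q ->
  exists Q : nat -> prime_idealr R, prime_chain n.+1 Q /\ Q n.+1 = q.
Proof.
move=> chP ltPq.
have [Q [chQ _ eqQ]] := chain_extend (r := fun p p' => strict_sub p p') chP ltPq.
by exists Q.
Qed.

Lemma height_ge0 p : height_ge 0 p.
Proof. by exists (fun _ => p). Qed.

Lemma height_geS n p q : height_ge n p -> strict_sub p q -> height_ge n.+1 q.
Proof.
move=> [P [chP eqPp]] [spq [y [yq yp]]].
have ltPq : strict_sub (P n) q.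
  by split=> [x|]; [rewrite eqPp; apply: spq | exists y; rewrite eqPp].
have [Q [chQ eqQ]] := prime_chain_extend chP ltPq.
by exists Q; split=> //; rewrite eqQ.
Qed.

Lemma height_ge_pred n p : height_ge n.+1 p -> height_ge n p.
Proof.
move=> [P [chP eqPp]].
exists (fun i => P i.+1); split=> // i lt_in; exact: chP.
Qed.

Lemma height_ge_leq n k p : (n <= k)%N -> height_ge k p -> height_ge n p.
Proof.
move=> /subnK <-; elim: (k - n)%N => //= i IHi /height_ge_pred; exact: IHi.
Qed.

(** A chain of length [d] whose top were strictly below [m] could be prolonged by [m], exceeding the
    dimension. *)
Lemma height_ge_maximal d (p : prime_idealr R) :
  krull_dim R d -> p =i m -> height_ge d p.
Proof.
move=> [[P chP] maxd] eqpm.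
have sPp : {subset P d <= p} by move=> x /prime_sub_maximal; rewrite eqpm.
have [eqPp|ltPp] := eq_or_strict_sub sPp; first by exists P.
by have [Q [/maxd]] := prime_chain_extend chP ltPp; rewrite ltnn.
Qed.

(* The next parameter only avoids the minimal primes of [x_1, ..., x_i] other
   than [m], since [m] already has height [d]; this spares Krull's height theorem. *)
Lemma parameters_height d i : krull_dim R d -> (i <= d)%N ->
  exists s : seq R, [/\ size s = i, forall x, x \in s -> x \in m &
    forall p : prime_idealr R, (forall x, x \in s -> x \in p) -> height_ge i p].
Proof.
move=> dimR; elim: i => [|i IHi] lt_id.
  by exists [::]; split=> // p _; apply: height_ge0.
have [s [size_s s_m s_ht]] := IHi (ltnW lt_id).
have [ps psP] := minimal_primes_finite (foldl (@adjoin R) (zeroI R) s) noeR.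
pose ps' := List.filter (fun p : prime_idealr R => ~~ `[<{subset m <= p}>]) ps.
have ps'P p : List.In p ps' <-> List.In p ps /\ ~ {subset m <= p}.
  by rewrite List.filter_In; split=> -[pin /asboolPn].
have [|x [xm xps']] := @prime_avoidance _ (ideal_of_idealr m) ps'.
  move=> p /ps'P[_ nsmp] smp; apply: nsmp => y ym.
  exact/smp/mem_ideal_of_idealr.
exists (x :: s); split=> /=; first by rewrite size_s.
  by move=> y /predU1P[->|/s_m //]; apply/mem_ideal_of_idealr.
move=> q s_q.
have [|p [pin sJp spq]] := psP q.
  move=> y ys; apply/mem_ideal_of_idealr.
  apply: (adjoins_sub (N := ideal_of_idealr q)) ys => [z /mem_zeroI->|z zs].
    exact: memI0.
  by apply/mem_ideal_of_idealr/s_q; rewrite inE zs orbT.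
have p_ht : height_ge i p by apply: s_ht => y ys; apply/sJp/adjoins_gen.
(* A strict inclusion of [p] in [q] raises the height by one. If [p = q], then [p] contains [x], so
   it was not among the avoided primes and must be [m]. *)
have [eqpq|ltpq] := eq_or_strict_sub spq; last exact: height_geS ltpq.
apply: (height_ge_leq lt_id); apply: height_ge_maximal => //.
have xp : x \in p by rewrite eqpq; apply: s_q; rewrite mem_head.
have smp : {subset m <= p}.
  apply: contrapT => nsmp; have /xps' : List.In p ps' by apply/ps'P.
  by rewrite xp.
move=> y; rewrite -eqpq; apply/idP/idP => [|/smp //].
exact: prime_sub_maximal.
Qed.

(** A prime containing [s] has height at least [d]; were it strictly inside [m], then [m] would have
    height at least [d.+1]. *)
Lemma system_of_parameters d : krull_dim R d ->
  exists s : seq R, [/\ size s = d, forall x, x \in s -> x \in m &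
    forall p : prime_idealr R, (forall x, x \in s -> x \in p) -> p =i m].
Proof.
move=> dimR; have [s [size_s s_m s_ht]] := parameters_height dimR (leqnn d).
exists s; split=> // p s_p; have [P [chP eqPp]] := s_ht p s_p.
have [pm eqpm] := maximal_ideal_prime.
have spm : {subset p <= pm} by move=> x /prime_sub_maximal; rewrite eqpm.
have [eqp|ltp] := eq_or_strict_sub spm; first by move=> x; rewrite eqp eqpm.
have [Q [chQ _]] : height_ge d.+1 pm by apply: height_geS ltp; exists P.
by have := dimR.2 _ _ chQ; rewrite ltnn.
Qed.

End LocalRing.

(** * Colength measured by chains of ideals *)

Section Length.
Local Open Scope ring_scope.
Variable R : comNzRingType.
Implicit Types (J : ideal R) (a x y : R) (s : seq R).

(** Chains of ideals above [J] stand for chains of submodules of [R/J]; [quotmod_chainP] justifies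
    this. *)
Definition ideal_chain J n (N : nat -> ideal R) : Prop :=
  submod_chain n N /\ {subset J <= N 0%N}.

(** Bounds the length of [R/J] within the natural numbers, so finiteness is included and no extended
    reals occur. *)
Definition colength_le J (k : nat) : Prop :=
  forall n N, ideal_chain J n N -> (n <= k)%N.

Lemma colength_le_sub J J' k :
  {subset J <= J'} -> colength_le J k -> colength_le J' k.
Proof. by move=> sJJ' lJ n N [chN sJN]; apply: (lJ n N); split=> // x /sJJ' /sJN. Qed.

Lemma ideal_chain_extend J n (N : nat -> ideal R) (T T' : ideal R) :
  ideal_chain J n N -> N n =i T -> {subset T <= T'} ->
  T =i T' \/ exists N', ideal_chain J n.+1 N' /\ N' n.+1 =i T'.
Proof.
move=> [chN sJN] eqNT sTT'.
have [eqTT'|[_ [y [yT' yT]]]] := eq_or_strict_sub sTT'; [by left | right].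
have ltNT' : strict_sub (N n) T'.
  by split=> [z|]; [rewrite eqNT; exact: sTT' | exists y; rewrite eqNT].
have [N' [chN' N'0 N'n]] :=
  chain_extend (r := fun A B : ideal R => strict_sub A B) chN ltNT'.
by exists N'; rewrite N'n; split=> //; split=> //; rewrite N'0.
Qed.

(* A step with [(N_i : a) = (N_i.+1 : a)] and [N_i + aR = N_i.+1 + aR] is an
   equality, so each strict step survives in one of the two chains. *)
Lemma ideal_chain_split J a n (N : nat -> ideal R) : ideal_chain J n N ->
  exists i j A B, [/\ (n <= i + j)%N,
    ideal_chain (colon J a) i A /\ A i =i colon (N n) a &
    ideal_chain (adjoin J a) j B /\ B j =i adjoin (N n) a].
Proof.
have sub_colon (N1 N2 : ideal R) :
    {subset N1 <= N2} -> {subset colon N1 a <= colon N2 a}.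
  by move=> sN x /mem_colon /sN xN; apply/mem_colon.
have adj_sub (N1 N2 : ideal R) :
    {subset N1 <= N2} -> {subset adjoin N1 a <= adjoin N2 a}.
  move=> sN; apply: adjoin_sub (adjoin_gen _ _).
  by move=> x /sN; apply: sub_adjoin.
elim: n => [|n IHn] [chN sJN].
  exists 0%N, 0%N, (fun=> colon (N 0%N) a), (fun=> adjoin (N 0%N) a).
  by split=> //; split=> //; split=> //; [apply: sub_colon | apply: adj_sub].
have [|i [j [A [B [le_n [chA eqA] [chB eqB]]]]]] := IHn.
  by split=> // i lt_in; apply: chN; apply: ltnW.
have [sNN [y [yN' yN]]] := chN n (ltnSn n).
have [eqC|[A' [chA' eqA']]] := ideal_chain_extend chA eqA (sub_colon _ _ sNN);
  have [eqD|[B' [chB' eqB']]] := ideal_chain_extend chB eqB (adj_sub _ _ sNN).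
(* Neither chain grows: write [y = r * a + u] with [u] in [N n]. Then [r * a] is in [N n.+1], and
   equality of the colon ideals moves it into [N n], so [y] is in [N n] after all. *)
- case/negP: yN.
  have /mem_adjoin[r yrN] : y \in adjoin (N n) a by rewrite eqD sub_adjoin.
  apply: (memIBr _ yrN); rewrite mulrC; apply/mem_colon; rewrite eqC.
  apply/mem_colon; rewrite mulrC.
  by have := memIB yN' (sNN _ yrN); rewrite opprB addrC subrK.
- exists i, j.+1, A, B'; split=> //; first by rewrite addnS ltnS.
  by split=> // x; rewrite eqA eqC.
- exists i.+1, j, A', B; split=> //.
  by split=> // x; rewrite eqB eqD.
- exists i.+1, j.+1, A', B'; split=> //.
  by rewrite addSn ltnS addnS leqW.
Qed.

(** This is the half needed of additivity of length along the exact sequence from [R/(J : a)]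
    (multiplication by [a]) through [R/J] to [R/(J + aR)]. *)
Lemma colength_le_split J a k l :
  colength_le (colon J a) k -> colength_le (adjoin J a) l -> colength_le J (k + l).
Proof.
move=> lk ll n N /(ideal_chain_split a)[i [j [A [B [le_n [chA _] [chB _]]]]]].
by apply: leq_trans le_n (leq_add (lk _ _ chA) (ll _ _ chB)).
Qed.

Lemma colength_le_unit J k : (1 : R) \in J -> colength_le J k.
Proof.
move=> J1 [//|n] N [chN sJN]; have [_ [y [_ /negP[]]]] := chN 0%N isT.
by rewrite -[y]mulr1; apply/memIM/sJN.
Qed.

(** Since [a * b] is in [J], the ideal [J + bR] is contained in [(J : a)]. *)
Lemma colength_le_mul J a b k l : a * b \in J ->
  colength_le (adjoin J a) k -> colength_le (adjoin J b) l -> colength_le J (l + k).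
Proof.
move=> abJ lk ll; apply: colength_le_split lk.
apply: colength_le_sub ll; apply: adjoin_sub; last exact/mem_colon.
by move=> x xJ; apply/mem_colon/memIM.
Qed.

(** Each splitting along [a] costs at most [k] and replaces [J] by [(J : a)], which contains the
    next lower power of [a]; the cost stays at most [k] because [(J : a) + aR] contains [J + aR]. *)
Lemma colength_le_exp J a n k : a ^+ n \in J ->
  colength_le (adjoin J a) k -> colength_le J (n * k).
Proof.
move=> anJ lk; elim: n J anJ lk => [|n IHn] J anJ lk.
  exact: colength_le_unit.
rewrite mulSn addnC; apply: (colength_le_split _ lk).
have sJC : {subset J <= colon J a} by move=> x xJ; apply/mem_colon/memIM.
apply: IHn; first by apply/mem_colon; rewrite -exprS.
apply: colength_le_sub lk; apply: adjoin_sub (adjoin_gen _ _) => x /sJC.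
exact: sub_adjoin.
Qed.

(** The elements of [s] are adjoined one at a time, each contributing a factor [n]. *)
Lemma colength_le_adjoins J s n k : (forall x, x \in s -> x ^+ n \in J) ->
  colength_le (foldl (@adjoin R) J s) k -> colength_le J (n ^ size s * k).
Proof.
elim: s J => [|a s IHs] J snJ /=; first by rewrite expn0 mul1n.
move=> /IHs lk; rewrite expnS -mulnA; apply: (colength_le_exp (a := a)).
  by apply: snJ; rewrite mem_head.
by apply: lk => x xs; apply/sub_adjoin/snJ; rewrite inE xs orbT.
Qed.

(** In the prime case [J] is [m] and the colength is at most 1; in the product case the bounds for
    the two enlarged ideals add up. *)
Lemma colength_finite J (m : idealr R) :
  noetherian R -> local_ring m ->
  (forall p : prime_idealr R, (forall x, x \in J -> x \in p) -> p =i m) ->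
  exists k, colength_le J k.
Proof.
move=> noeR locR; elim/(noetherian_prime_ind): J => //.
- by move=> J J1 _; exists 0%N; apply: colength_le_unit.
- move=> J p eqJp pm; exists 1%N => n N [chN sJN].
  rewrite leqNgt; apply/negP => lt1n.
  have [sN01 [y [yN1 yN0]]] := chN 0%N (ltnW lt1n).
  have [_ [z [zN2 zN1]]] := chN 1%N lt1n.
  have N11 : (1 : R) \notin N 1%N.
    by apply/negP => N11; case/negP: zN1; rewrite -[z]mulr1; apply: memIM.
  (* In a chain of length 2 the middle ideal is proper, so it lies in [m], which is [J] and hence
     contained in [N 0]. *)
  case/negP: yN0; apply: sJN; rewrite eqJp pm; last by move=> x; rewrite eqJp.
  exact: (proper_sub_maximal noeR locR N11).
- move=> J a b abJ IHa IHb pm.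
  have [|k lk] := IHa.
    by move=> p sJp; apply: pm => x xJ; apply/sJp/sub_adjoin.
  have [|l ll] := IHb.
    by move=> p sJp; apply: pm => x xJ; apply/sJp/sub_adjoin.
  by exists (l + k)%N; apply: colength_le_mul lk ll.
Qed.

(** The correspondence theorem: preimages in one direction, images in the other. *)
Lemma quotmod_chainP J n :
  (exists N : nat -> submodClosed (quotmod J), submod_chain n N) <->
  (exists N : nat -> ideal R, ideal_chain J n N).
Proof.
pose pi (x : R) : quotmod J := (\pi_(quotmod J) (x : R^o))%qT.
have piE x y : pi x = pi y <-> x - y \in J.
  by rewrite -(quotmod_piE J); split => [/eqP|/eqP].
have piD x y : pi (x + y) = pi x + pi y by exact: quotmod_piD.
have piZ a x : pi (a * x) = a *: pi x by exact: esym (quotmod_piZ J a (x : R^o)).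
have pi0 : pi 0 = 0 by have := piZ 0 0; rewrite mul0r scale0r.
split=> -[N].
  have preimP i : @submod_axioms R R^o (fun x : R => pi x \in N i).
    apply: ideal_axioms => [|x y|a x] /=; first by rewrite pi0 rpred0.
      by rewrite piD; apply: rpredD.
    by rewrite piZ; apply: rpredZ.
  move=> chN; exists (fun i => submod_of (preimP i)).
  have memP i (x : R) : x \in submod_of (preimP i) <-> pi x \in N i.
    exact: (mem_submod_of (preimP i) x).
  split=> [i lt_in|x xJ]; last first.
    have /piE eqx0 : x - 0 \in J by rewrite subr0.
    by apply/memP; rewrite eqx0 pi0 rpred0.
  have [sN [y [yN' yN]]] := chN i lt_in.
  split=> [x /memP /sN xN|]; first exact/memP.
  have [v yE] := quotmod_pi_surj y; rewrite yE in yN' yN.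
  by exists v; split; [apply/memP | apply/negP => /memP; apply/negP].
have imP i : @submod_axioms R (quotmod J)
    (fun y : quotmod J => exists x : R, x \in N i /\ y = pi x).
  split=> [|_ _ [x [xN ->]] [y [yN ->]]|a _ [x [xN ->]]].
  - by exists 0; rewrite pi0 memI0.
  - by exists (x + y); rewrite piD memID.
  - by exists (a * x); rewrite piZ memIM.
move=> [chN sJN]; exists (fun i => submod_of (imP i)) => i lt_in.
have [sN [y [yN' yN]]] := chN i lt_in.
(* Images under the projection remain distinct because every [N i] contains its kernel [J]. *)
have sJi : {subset J <= N i}.
  elim: i lt_in {sN y yN' yN} => // i IHi lt_in x xJ.
  by apply: (chN i (ltnW lt_in)).1; apply: IHi xJ; apply: ltnW.
split=> [_ /mem_submod_of[x [/sN xN ->]]|]; first by apply/mem_submod_of; exists x.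
exists (pi y); split; first by apply/mem_submod_of; exists y.
apply/negP => /mem_submod_of[x [xN /piE /sJi yxN]]; case/negP: yN.
exact: memIBr yxN.
Qed.

(** Bounded chain lengths have a maximum, so the supremum is a natural number attained by some
    chain. Lengths can then be subtracted as finite numbers. *)
Lemma module_length_colength (K : realType) J k : colength_le J k ->
  exists l, [/\ module_length K (quotmod J) = (l%:R)%:E, colength_le J l &
    exists N, ideal_chain J l N].
Proof.
move=> lk; pose has_chain n := `[<exists N, ideal_chain J n N>].
have ex0 : exists n, has_chain n.
  by exists 0%N; apply/asboolP; exists (fun=> J); split=> [[]|].
have ub n : has_chain n -> (n <= k)%N by move=> /asboolP[N /lk].
have [l /asboolP chl maxl] := ex_maxnP ex0 ub.
exists l; split=> //; last by move=> n N chN; apply: maxl; apply/asboolP; exists N.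
apply/eqP; rewrite eq_le; apply/andP; split.
  apply: ge_ereal_sup => _ [n /quotmod_chainP chn <-].
  by rewrite lee_fin ler_nat; apply: maxl; apply/asboolP.
by apply: ereal_sup_ubound; exists l => //; apply/quotmod_chainP.
Qed.

End Length.

(** * Graded families and parameters inside [I 1] *)

Section GradedFamily.
Local Open Scope ring_scope.
Variables (R : comNzRingType) (m : idealr R) (I : nat -> ideal R).
Hypothesis grI : graded_family m I.

Lemma graded_mul i j x y : x \in I i -> y \in I j -> x * y \in I (i + j)%N.
Proof.
case: grI => _ mulI _ xI yI; apply: mulI; exists [:: (x, y)]; split.
  by move=> p; rewrite inE => /eqP ->.
by rewrite big_seq1.
Qed.

Lemma graded_exp n x : x \in I 1%N -> x ^+ n \in I n.
Proof.
move=> xI; elim: n => [|n IHn]; first by case: grI.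
by rewrite exprS -add1n; apply: graded_mul.
Qed.

Lemma exp_in_first (s : seq R) : (forall x, x \in s -> x \in m) ->
  exists k, forall x, x \in s -> x ^+ k.+1 \in I 1%N.
Proof.
elim: s => [|a s IHs] sm; first by exists 0%N.
have [|k sk] := IHs; first by move=> x xs; apply: sm; rewrite inE xs orbT.
have [_ _ /(_ 1%N isT)[_ radI]] := grI.
have /radI[j aj] : a \in m by apply: sm; rewrite mem_head.
(* The sum of the exponents serves [a] and all of [s] at once, as ideals absorb further factors. *)
exists (j + k)%N => x; rewrite inE => /predU1P[->|/sk xk].
  by rewrite -addnS addnC exprD memIM.
by rewrite -addnS exprD memIM.
Qed.

End GradedFamily.

(** High powers of a system of parameters lie in [I 1], and a prime containing them contains the
    original parameters, so it is still [m]; hence the colength is finite. *)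
Lemma parameters_in_first (R : comNzRingType) (m : idealr R) (d : nat)
  (I : nat -> ideal R) :
  noetherian R -> local_ring m -> krull_dim R d -> graded_family m I ->
  exists (s : seq R) (k : nat), [/\ size s = d, forall x, x \in s -> x \in I 1 &
    colength_le (foldl (@adjoin R) (zeroI R) s) k].
Proof.
move=> noeR locR dimR grI.
have [s [size_s s_m s_p]] := system_of_parameters noeR locR dimR.
have [e se] := exp_in_first grI s_m.
pose t := [seq (x ^+ e.+1)%R | x <- s]; exists t.
have [k lk] : exists k, colength_le (foldl (@adjoin R) (zeroI R) t) k.
  apply: (colength_finite noeR locR) => p t_p; apply: s_p => x xs.
  apply: (@prime_mem_exp _ p x e.+1); apply: t_p.
  by apply: adjoins_gen; apply: map_f.
exists k; split=> //; first by rewrite size_map.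
by move=> _ /mapP[x xs ->]; apply: se.
Qed.

(** * The growth bound *)

Theorem theorem1p1 (K : realType) (R : comNzRingType) (m : idealr R) (d : nat)
  (I : nat -> ideal R) :
  noetherian R -> local_ring m -> krull_dim R d -> (0 < d)%N ->
  graded_family m I ->
  exists gamma : K, (0 < gamma)%R /\
    forall n : nat, (1 <= n)%N ->
      (module_length K (quotmod (I n.+1)) - module_length K (quotmod (I n))
       < (gamma * n%:R ^+ d.-1)%R%:E)%E.
Proof.
move=> noeR locR dimR d_gt0 grI.
have [s [k [size_s sI1 lk]]] := parameters_in_first noeR locR dimR grI.
(* This coarse bound of order [n ^ d] serves only to make the lengths finite. *)
have lI (J : ideal R) n : (forall x, x \in s -> (x ^+ n)%R \in J) ->
    colength_le J (n ^ d * k).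
  move=> snJ; rewrite -size_s; apply: colength_le_adjoins => //.
  apply: colength_le_sub lk; apply: adjoins_sub; last exact: adjoins_gen.
  by move=> x /mem_zeroI ->; apply: memI0.
case: s => [|a s] in size_s sI1 lk lI *; first by rewrite -size_s in d_gt0.
(* The factor [2 ^ d.-1] comes from [n.+1 <= 2 * n]; the successor makes the constant positive and
   the inequality strict. *)
exists ((k * 2 ^ d.-1).+1%:R)%R; split; first by rewrite ltr0n.
move=> n n_gt0.
have exI i x : x \in a :: s -> (x ^+ i)%R \in I i.
  by move=> /sI1; exact: graded_exp grI _ _.
have [l [-> ll _]] := module_length_colength K (lI _ _ (exI n)).
have [l' [-> _ [N chN]]] := module_length_colength K (lI _ _ (exI n.+1)).
(* As [a] itself is adjoined, only the remaining [d.-1] parameters contribute a factor [n.+1]. *)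
have ladj : colength_le (adjoin (I n.+1) a) (n.+1 ^ d.-1 * k).
  rewrite -size_s; apply: (colength_le_adjoins (s := s)) => [x xs|].
    by apply/sub_adjoin/exI; rewrite inE xs orbT.
  apply: colength_le_sub lk; apply: (adjoins_sub (s := a :: s)).
    by move=> x /mem_zeroI ->; apply: memI0.
  move=> x; rewrite inE => /predU1P[->|]; last exact: adjoins_gen.
  exact/sub_adjoins/adjoin_gen.
(* Since [a] is in [I 1], multiplication by [a] sends [I n] into [I n.+1], so [I n] lies in the
   colon ideal; no inclusion between [I n] and [I n.+1] is involved. *)
have lcol : colength_le (colon (I n.+1) a) l.
  apply: colength_le_sub ll => x xI; apply/mem_colon; rewrite -add1n.
  by apply: (graded_mul grI) xI; apply: sI1; rewrite mem_head.
have le_l' := colength_le_split lcol ladj chN.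
rewrite -EFinB lte_fin -natrX -natrM ltrBlDl -natrD ltr_nat.
apply: leq_ltn_trans le_l' _; rewrite ltn_add2l.
apply: (@leq_ltn_trans (k * 2 ^ d.-1 * n ^ d.-1)).
  rewrite mulnC -mulnA leq_mul2l -expnMn.
  (* Exponent 0 is treated apart: comparing bases through [leq_exp2r] requires a positive
     exponent. *)
  case: d.-1 => [|e]; rewrite ?expn0 ?orbT // leq_exp2r // mul2n -addnn.
  by rewrite -addn1 leq_add2l n_gt0 orbT.
by rewrite ltn_pmul2r // expn_gt0 n_gt0.
Qed.
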